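(* Let $(p_t)_{t\ge 1}$ be a sequence of (random) probability densities on $\mathcal{Y}$ such that each $p_t$ is $\mathcal{F}_{t-1}$-measurable. For each $n\ge 1$ let $\overline{\theta}_n\in\mathbb{R}^d$ be a data-dependent reference parameter (a measurable function of $X_1,Y_1,\dots,X_n,Y_n$). Let $\delta\in(0,1)$ and, for each $n\ge 1$, define $$\beta_n=\mathrm{regret}_{p^n}(\overline{\theta}_n)+\log\frac1\delta,\qquad \Theta_n=\Big\{\theta\in\mathbb{R}^d:\ \sum_{t=1}^n\big(\ell_t(\theta)-\ell_t(\overline{\theta}_n)\big)\le\beta_n\Big\}.$$ Then $\mathbb{P}\big[\exists n\ge 1:\ \theta^\star\notin\Theta_n\big]\le\delta$.
   Context: Generalized linear model (GLM). Fix $d\ge1$. Labels take values in a measurable set $\mathcal{Y}\subseteq\mathbb{R}$ equipped with a fixed $\sigma$-finite reference measure $\mathrm{d}y$ (e.g. Lebesgue or counting measure); all densities on $\mathcal{Y}$ are with respect to it. Let $h:\mathcal{Y}\to[0,\infty)$ and let $\psi:\mathbb{R}\to\mathbb{R}$ be convex and differentiable, such that for all $x,\theta\in\mathbb{R}^d$ the function $p(y|x,\theta)=\exp(\langle\theta,x\rangle y-\psi(\langle\theta,x\rangle))h(y)$ is a probability density on $\mathcal{Y}$. The data are random pairs $(X_t,Y_t)_{t\ge1}$ with $X_t\in\mathbb{R}^d$, $Y_t\in\mathcal{Y}$; let $\mathcal{F}_t=\sigma(X_1,Y_1,\dots,X_t,Y_t,X_{t+1})$ and $\mathcal{F}_0=\sigma(X_1)$.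 Covariates may be chosen adaptively (i.e. $X_{t+1}$ may depend on the past). For a fixed unknown $\theta^\star\in\mathbb{R}^d$ and every $t\ge 1$, the conditional density of $Y_t$ given $\mathcal{F}_{t-1}$ is $p(\cdot|X_t,\theta^\star)$. Losses: $\ell_t(\theta)=-\langle\theta,X_t\rangle Y_t+\psi(\langle\theta,X_t\rangle)-\log h(Y_t)=-\log p(Y_t|X_t,\theta)$. For a probability density $p$ on $\mathcal{Y}$, the log loss is $\mathcal{L}_t(p)=-\log p(Y_t)$. For $p^n=(p_1,\dots,p_n)$ and $\bar\theta\in\mathbb{R}^d$, $\mathrm{regret}_{p^n}(\bar\theta)=\sum_{t=1}^n(\mathcal{L}_t(p_t)-\ell_t(\bar\theta))$. ''$p_t$ is $\mathcal{F}_{t-1}$-measurable'' means $(\omega,y)\mapsto p_t(\omega,y)$ is jointly measurable with respect to $\mathcal{F}_{t-1}$ and the $\sigma$-algebra on $\mathcal{Y}$. *)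

(* Defs.v *)
From HB Require Import structures.
From mathcomp Require Export all_boot all_order all_algebra.
From mathcomp Require Export all_classical all_reals all_analysis.

Set Implicit Arguments.
Unset Strict Implicit.
Unset Printing Implicit Defensive.

Import Order.TTheory GRing.Theory Num.Theory.
Import numFieldNormedType.Exports.

Local Open Scope classical_set_scope.
Local Open Scope ring_scope.

Definition dotv (R : realType) (d : nat) (u v : 'rV[R]_d) : R :=
  \sum_(i < d) u 0 i * v 0 i.

(* The Borel sigma-algebra of R^d is the product one, so measurability of an
   R^d-valued map is measurability of its coordinates. *)
Definition measurable_rV (R : realType) (d : nat) (disp : measure_display)
    (T : measurableType disp) (f : T -> 'rV[R]_d) : Prop :=
  forall i : 'I_d, measurable_fun setT (fun w => f w 0 i).

(* The label space is a measurable set [Ysp] of reals, and its reference measure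
   is the restriction of [mu] to [Ysp]. Only the values on [Ysp] of functions of
   a label matter. *)
Definition is_density (R : realType) (Ysp : set (measurableTypeR R))
    (mu : {measure set (measurableTypeR R) -> \bar R}) (f : R -> R) : Prop :=
  [/\ measurable_fun Ysp (f : measurableTypeR R -> R),
      (forall y, Ysp y -> 0 <= f y) &
      (\int[mu]_(y in Ysp) (f y)%:E = 1)%E].

Section glm.
Context {R : realType} {d : nat}.
Variables (psi h : R -> R).

Definition glm_density (x theta : 'rV[R]_d) (y : R) : R :=
  expR (dotv theta x * y - psi (dotv theta x)) * h y.

(* Losses take the value +oo where the density vanishes ([lne 0 = -oo]). The
   undefined difference +oo - +oo (which is -oo in [\bar R]) of two values of
   [glm_loss] only occurs where [h y = 0], a null event for the labels. *)
Definition glm_loss (x : 'rV[R]_d) (y : R) (theta : 'rV[R]_d) : \bar R :=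
  ((- (dotv theta x * y) + psi (dotv theta x))%:E - lne (h y)%:E)%E.

Definition log_loss (p : R -> R) (y : R) : \bar R := (- lne (p y)%:E)%E.

End glm.

Section data.
Context {R : realType} {d : nat} {Omega : Type}.
Variables (X : nat -> Omega -> 'rV[R]_d) (Y : nat -> Omega -> R).

(* sigma(X_1, .., X_m, Y_1, .., Y_k); index 0 of the processes is unused *)
Definition sigma_data (m k : nat) : set_system Omega :=
  <<s (\bigcup_(t in [set t | (1 <= t <= m)%N]) \bigcup_(i in [set: 'I_d])
         preimage_set_system setT (fun w => X t w 0 i)
           (@measurable _ (measurableTypeR R)))
      `|`
      (\bigcup_(t in [set t | (1 <= t <= k)%N])
         preimage_set_system setT (Y t)
           (@measurable _ (measurableTypeR R))) >>.

Definition filtration (t : nat) : set_system Omega := sigma_data t.+1 t.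

End data.

Section conditioning.
Context {R : realType} {disp : measure_display} {Omega : measurableType disp}.
Variables (Ysp : set (measurableTypeR R)) (F : set_system Omega).

Definition jointly_measurable (q : Omega -> R -> R) : Prop :=
  measurable_fun (setT `*` Ysp)
    (fun z : g_sigma_algebraType F * measurableTypeR R => q z.1 z.2).

Definition conditional_density (P : probability Omega R)
    (mu : {measure set (measurableTypeR R) -> \bar R})
    (Z : Omega -> R) (q : Omega -> R -> R) : Prop :=
  jointly_measurable q /\
  forall (A : set Omega) (B : set (measurableTypeR R)),
    F A -> measurable B -> B `<=` Ysp ->
    (P (A `&` Z @^-1` B) = \int[P]_(w in A) \int[mu]_(y in B) (q w y)%:E)%E.

End conditioning.

Section confidence.
Context {R : realType} {d : nat} {Omega : Type}.
Variables (psi h : R -> R).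
Variables (X : nat -> Omega -> 'rV[R]_d) (Y : nat -> Omega -> R).
Variables (p : nat -> Omega -> R -> R) (thetabar : nat -> Omega -> 'rV[R]_d).
Local Open Scope ereal_scope.

Definition loss (t : nat) (w : Omega) (theta : 'rV[R]_d) : \bar R :=
  glm_loss psi h (X t w) (Y t w) theta.

Definition regret (n : nat) (w : Omega) (theta : 'rV[R]_d) : \bar R :=
  \sum_(1 <= t < n.+1) (log_loss (p t w) (Y t w) - loss t w theta).

Definition beta (delta : R) (n : nat) (w : Omega) : \bar R :=
  regret n w (thetabar n w) + (ln (1 / delta))%:E.

Definition conf_set (delta : R) (n : nat) (w : Omega) : set 'rV[R]_d :=
  [set theta | \sum_(1 <= t < n.+1) (loss t w theta - loss t w (thetabar n w))
               <= beta delta n w].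

End confidence.

(* Main.v *)
(* With q_t(y) = p(y|X_t,thetastar) the likelihood ratios
   M_n = prod_(t<=n) p_t(Y_t)/q_t(Y_t) form a nonnegative supermartingale with
   M_0 = 1: given F_(t-1), Y_t has density q_t, so the conditional expectation
   of p_t(Y_t)/q_t(Y_t) is the integral of p_t over {q_t > 0}, at most 1.  As
   the losses of the reference parameter cancel, thetastar leaves the confidence
   set at time n only if M_n > 1/delta (outside the null event that some h(Y_t)
   vanishes), which Ville's inequality bounds by delta. *)
From HB Require Import structures.
From mathcomp Require Import measurable_realfun.
Require Import Defs.
From mathcomp Require Import ring.

Set Implicit Arguments.
Unset Strict Implicit.
Unset Printing Implicit Defensive.

Import Order.TTheory GRing.Theory Num.Theory.
Import numFieldNormedType.Exports.

Local Open Scope classical_set_scope.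
Local Open Scope ring_scope.

(** * Integrals against a measure given by a density *)

Section integral_density.
Context d (T : measurableType d) (R : realType).
Variables (m nu : {measure set T -> \bar R}) (q : T -> R).
Hypotheses (mq : measurable_fun setT q) (q0 : forall x, 0 <= q x).
Hypothesis nuE : forall A, measurable A -> nu A = (\int[m]_(x in A) (q x)%:E)%E.
Local Open Scope ereal_scope.
Import HBNNSimple.

Let density_indic (A : set T) : measurable A ->
  \int[nu]_x (\1_A x)%:E = \int[m]_x ((\1_A x)%:E * (q x)%:E).
Proof.
move=> mA; rewrite integral_indic// setIT nuE// integral_mkcond.
by apply: eq_integral => x _; rewrite epatch_indic muleC.
Qed.

Let mqE : measurable_fun setT (EFin \o q).
Proof. exact/measurable_EFinP. Qed.

(** [nuE] settles indicators, linearity extends this to simple functions, and monotone convergence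
    along [nnsfun_approx], applied on both sides, reaches every nonnegative measurable [f]. *)
Lemma ge0_integral_density (f : T -> \bar R) :
    measurable_fun setT f -> (forall x, 0 <= f x) ->
  \int[nu]_x f x = \int[m]_x (f x * (q x)%:E).
Proof.
move=> mf f0; pose h := nnsfun_approx measurableT mf.
have cvgh x : (h n x)%:E @[n --> \oo] --> f x by exact: cvg_nnsfun_approx.
have ndh x : {homo (fun n => h n x) : a b / (a <= b)%N >-> (a <= b)%R}.
  by move=> a b ab; exact/lefP/nd_nnsfun_approx.
transitivity (limn (fun n => \int[nu]_x (h n x)%:E)).
  rewrite -monotone_convergence//.
  - by apply: eq_integral => x _; apply/esym/cvg_lim.
  - by move=> n; exact/measurable_EFinP.
  - by move=> n x _; rewrite lee_fin.
  - by move=> x _ a b ab; rewrite lee_fin ndh.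
transitivity (limn (fun n => \int[m]_x ((h n x)%:E * (q x)%:E))); last first.
  rewrite -monotone_convergence//.
  - by apply: eq_integral => x _; apply/cvg_lim => //; exact: cvgeZr.
  - move=> n; apply: emeasurable_funM => //; exact/measurable_EFinP.
  - by move=> n x _; rewrite mule_ge0// lee_fin.
  - by move=> x _ a b ab; rewrite lee_wpmul2r ?lee_fin// ndh.
congr (limn _); apply/funext => n.
have mind r :
    measurable_fun setT (fun x => (\1_(h n @^-1` [set r]) x)%:E : \bar R).
  by apply/measurable_EFinP; exact: measurable_indic.
transitivity (\sum_(r \in range (h n))
    \int[nu]_x (r * \1_(h n @^-1` [set r]) x)%:E).
  under eq_integral do rewrite fimfunE -fsumEFin//.
  rewrite ge0_integral_fsum//.
  - by move=> r; apply/measurable_EFinP; exact: measurable_funM.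
  - by move=> r x _; exact: nnfun_muleindic_ge0.
under [RHS]eq_integral => x _.
  rewrite fimfunE -fsumEFin// ge0_mule_fsuml//; last first.
    by move=> r; exact: nnfun_muleindic_ge0.
  over.
rewrite ge0_integral_fsum//; last 2 first.
- move=> r; apply: emeasurable_funM => //.
  by apply/measurable_EFinP; exact: measurable_funM.
- by move=> r x _; rewrite mule_ge0 ?lee_fin// -lee_fin nnfun_muleindic_ge0.
apply: eq_fsbigr => r /[!inE] -[x _ <-].
rewrite integralZl_indic_nnsfun// density_indic//.
under [RHS]eq_integral do rewrite EFinM -muleA.
rewrite ge0_integralZl_EFin//.
- by move=> z _; rewrite mule_ge0 ?lee_fin.
- exact: emeasurable_funM.
Qed.

End integral_density.

(** The restricted measure has density [\1_D] with respect to [m], so the previous lemma applies. *)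
Lemma ge0_integral_mrestr d (T : measurableType d) (R : realType)
    (m : {measure set T -> \bar R}) (D : set T) (mD : measurable D)
    (f : T -> \bar R) :
    measurable_fun setT f -> (forall x, 0 <= f x)%E ->
  (\int[mrestr m mD]_x f x = \int[m]_(x in D) f x)%E.
Proof.
move=> mf f0.
rewrite (@ge0_integral_density _ _ _ m _ (\1_D : T -> R))//.
- by rewrite [RHS]integral_mkcond; apply: eq_integral => x _;
    rewrite epatch_indic.
- by move=> A mA; rewrite integral_indic// setIC.
Qed.

(** * Disintegration of a joint law along a conditional density *)

Section disintegration.
Context d0 d1 d2 (Omega : measurableType d0) (T1 : measurableType d1)
  (T2 : measurableType d2) (R : realType).
Variables (P : probability Omega R).
Variables (m : {sigma_finite_measure set T2 -> \bar R}).
Variables (W : {mfun Omega >-> T1}) (Z : {mfun Omega >-> T2}).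
Variable q : T1 * T2 -> R.
Hypotheses (mq : measurable_fun setT q) (q0 : forall z, 0 <= q z).
Local Open Scope ereal_scope.
Hypothesis PE : forall A B, measurable A -> measurable B ->
  P (W @^-1` A `&` Z @^-1` B) =
    \int[P]_(w in W @^-1` A) \int[m]_(y in B) (q (W w, y))%:E.

Let WZ (w : Omega) := (W w, Z w).

Let mWZ : measurable_fun setT WZ.
Proof. exact: measurable_fun_pair. Qed.

HB.instance Definition _ := isMeasurableFun.Build _ _ _ _ WZ mWZ.

Let mqE : measurable_fun setT (EFin \o q).
Proof. exact/measurable_EFinP. Qed.

Let prodm := distribution P W \x m.

Let nu (C : set (T1 * T2)) := \int[prodm]_(z in C) (q z)%:E.

Let nu0 : nu set0 = 0. Proof. exact: integral_set0. Qed.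

Let nu_ge0 C : 0 <= nu C.
Proof. by apply: integral_ge0 => z _; rewrite lee_fin. Qed.

Let nu_sigma_additive : semi_sigma_additive nu.
Proof. exact: semi_sigma_additive_nng_induced. Qed.

HB.instance Definition _ := isMeasure.Build _ _ _
  nu nu0 nu_ge0 nu_sigma_additive.

Let distr_rect (A : set T1) (B : set T2) : measurable A -> measurable B ->
  distribution P WZ (A `*` B) = nu (A `*` B).
Proof.
move=> mA mB; rewrite /nu integral_mkcond fubini_tonelli1/=; first last.
- by move=> z; apply: erestrict_ge0 => ? _; rewrite lee_fin.
- apply/(measurable_restrictT _ _).1 => //; first exact: measurableX.
  exact: measurable_funTS.
rewrite ge0_integral_distribution; first last.
- move=> x; apply: integral_ge0 => y _.
  by apply: erestrict_ge0 => ? _; rewrite lee_fin.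
- apply: measurable_fun_fubini_tonelli_F.
    apply/(measurable_restrictT _ _).1 => //; first exact: measurableX.
    exact: measurable_funTS.
  by move=> z; apply: erestrict_ge0 => ? _; rewrite lee_fin.
rewrite [LHS](PE mA mB) integral_mkcond; apply: eq_integral => w _;
  rewrite /fubini_F.
rewrite patchE; case: ifPn => wA.
  rewrite integral_mkcond; apply: eq_integral => y _.
  by rewrite !patchE in_setX/= -[W w \in A]/(w \in W @^-1` A) wA.
rewrite /= integral0_eq// => y _.
by rewrite patchE in_setX/= -[W w \in A]/(w \in W @^-1` A) (negbTE wA).
Qed.

(** Rectangles are closed under intersection and generate the product sigma-algebra. The law of the
    pair is finite, so the constant cover by [setT] suffices for uniqueness. *)
Let distrE C : measurable C -> distribution P WZ C = nu C.
Proof.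
move=> mC.
apply: (@measure_unique _ R _
  [set A `*` B | A in measurable & B in measurable] (fun=> setT)) => //.
- exact: measurable_prod_measurableType.
- move=> _ _ [A1 mA1 [B1 mB1 <-]] [A2 mA2 [B2 mB2 <-]].
  exists (A1 `&` A2); first exact: measurableI.
  by exists (B1 `&` B2); [exact: measurableI|rewrite setXI].
- by move=> _; exists setT => //; exists setT => //; rewrite setXTT.
- exact: bigcup_const.
- by move=> _ [A mA [B mB <-]]; exact: distr_rect.
- by move=> _; rewrite (le_lt_trans (probability_le1 _ _))// ltry.
Qed.

(* The law of (W, Z) and the measure with density q with respect to
   (law of W) x m agree on rectangles by PE, hence everywhere. *)
Lemma ge0_integral_disintegration (f : T1 * T2 -> \bar R) :
    measurable_fun setT f -> (forall z, 0 <= f z) ->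
  \int[P]_w f (W w, Z w) =
    \int[P]_w \int[m]_y (f (W w, y) * (q (W w, y))%:E).
Proof.
move=> mf f0.
transitivity (\int[distribution P WZ]_z f z).
  by rewrite ge0_integral_distribution.
rewrite (ge0_integral_density mq q0 distrE)// fubini_tonelli1; first last.
- by move=> z; rewrite mule_ge0 ?lee_fin.
- exact: emeasurable_funM.
rewrite ge0_integral_distribution//.
- apply: measurable_fun_fubini_tonelli_F; first exact: emeasurable_funM.
  by move=> z; rewrite mule_ge0 ?lee_fin.
- by move=> x; apply: integral_ge0 => y _; rewrite mule_ge0 ?lee_fin.
Qed.

End disintegration.

(** The pieces of [D] are enlarged by the complement of [D]: they then cover the whole space, and
    [mrestr] gives the added part no mass. *)
Lemma sigma_finite_mrestr d (T : measurableType d) (R : realType)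
    (m : {measure set T -> \bar R}) (D : set T) (mD : measurable D) :
  sigma_finite D m -> sigma_finite setT (mrestr m mD).
Proof.
move=> [F DF mF].
exists (fun n => F n `|` ~` D) => [|n].
  apply/esym/seteqP; split => // x _.
  have [Dx|nDx] := pselect (D x); last by exists 0%N => //; right.
  by move: Dx; rewrite DF => -[n _ Fx]; exists n => //; left.
have [mFn Fnoo] := mF n; split.
  by apply: measurableU => //; exact: measurableC.
rewrite /mrestr setIUl setICl setU0 (le_lt_trans _ Fnoo)// le_measure// inE//.
exact: measurableI.
Qed.

(** Serves to pass between a sub-sigma-algebra and the ambient one by composing with the
    identity. *)
Lemma measurable_id_sub d (T : measurableType d) (F : set_system T) :
  F `<=` measurable ->
  measurable_fun setT (id : T -> g_sigma_algebraType F).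
Proof.
move=> FT.
apply: (@measurability _ _ T (g_sigma_algebraType F) setT id F) => //.
by move=> _ [A FA <-]; rewrite setTI; exact: FT.
Qed.

(** * The one-step supermartingale inequality *)

Section one_step.
Context d (Omega : measurableType d) (R : realType).
Variables (Ysp : set (measurableTypeR R)) (mYsp : measurable Ysp).
Variables (mu : {measure set (measurableTypeR R) -> \bar R}).
Hypothesis mu_sigma_finite : sigma_finite Ysp mu.
Variables (F : set_system Omega) (P : probability Omega R).
Hypotheses (sF : sigma_algebra setT F) (subF : F `<=` measurable).
Variables (Z : Omega -> R) (p q : Omega -> R -> R).
Hypotheses (mZ : measurable_fun setT Z) (ZY : forall w, Ysp (Z w)).
Hypothesis q_ge0 : forall w y, Ysp y -> 0 <= q w y.
Hypothesis q_cond : conditional_density Ysp F P mu Z q.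
Hypothesis p_dens : forall w, is_density Ysp mu (p w).
Hypothesis p_meas : jointly_measurable Ysp F p.

Let m := mrestr mu mYsp.

HB.instance Definition _ := Measure.on m.
HB.instance Definition _ := Measure_isSigmaFinite.Build _ _ _ m
  (sigma_finite_mrestr mYsp mu_sigma_finite).

(** Encodes conditioning on [F]: the identity into the coarser space is a random element generating
    [F], so [F]-measurable data are functions of [W] and disintegration applies. *)
Let W : Omega -> g_sigma_algebraType F := id.

Let mW : measurable_fun setT W.
Proof. exact: measurable_id_sub. Qed.

HB.instance Definition _ := isMeasurableFun.Build _ _ _ _ W mW.
HB.instance Definition _ :=
  isMeasurableFun.Build _ _ _ _ (Z : Omega -> measurableTypeR R) mZ.

Let strip := setT `*` Ysp : set (g_sigma_algebraType F * measurableTypeR R).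

Let mstrip : measurable strip.
Proof. exact: measurableX. Qed.

(** [q] is controlled only for labels in [Ysp]; its extension by zero is measurable and nonnegative
    everywhere, as integration against [m] on the whole line requires. *)
Let qs := (fun z => q z.1 z.2) \_ strip.

Let mqs : measurable_fun setT qs.
Proof. exact: ((measurable_restrictT _ mstrip).1 q_cond.1). Qed.

Let qs_ge0 z : 0 <= qs z.
Proof.
rewrite /qs patchE; case: ifPn => // /[!inE] -[_ Yz]; exact: q_ge0.
Qed.

Let integral_strip (f : measurableTypeR R -> \bar R) :
  measurable_fun setT f -> (forall y, 0 <= f y)%E ->
  (\int[m]_y f y = \int[mu]_(y in Ysp) f y)%E.
Proof. exact: ge0_integral_mrestr. Qed.

Let sigmaE (A : set (g_sigma_algebraType F)) : measurable A -> F A.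
Proof. by rewrite /measurable/= sigma_algebra_id. Qed.

Let mqs_y w : measurable_fun setT (fun y => (qs (w, y))%:E).
Proof.
apply/measurable_EFinP.
exact: (measurableT_comp mqs (pair1_measurable w)).
Qed.

Let qsE w y : Ysp y -> qs (w, y) = q w y.
Proof. by move=> Yy; rewrite /qs patchE ifT// inE. Qed.

(** [q_cond] speaks only of [B] inside [Ysp]. Since [Z] takes its values there, [B] can be cut down
    to its intersection with [Ysp]. *)
Let cond_rect (A : set (g_sigma_algebraType F)) (B : set (measurableTypeR R)) :
    measurable A -> measurable B ->
  (P (W @^-1` A `&` (Z : Omega -> measurableTypeR R) @^-1` B) =
   \int[P]_(w in W @^-1` A) \int[m]_(y in B) (qs (W w, y))%:E)%E.
Proof.
move=> mA mB.
have -> : W @^-1` A `&` Z @^-1` B = A `&` Z @^-1` (B `&` Ysp).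
  by apply/seteqP; split => w [Aw Bw]; split => //; case: Bw.
rewrite q_cond.2//; [|exact: sigmaE|exact: measurableI].
apply: eq_integral => w _.
rewrite integral_mkcondl [RHS]integral_mkcond integral_strip.
- apply: eq_integral => y /[!inE] Yy; rewrite !patchE.
  by case: ifPn => // _; rewrite qsE.
- by apply: ((measurable_restrictT _ mB).1 _); exact: measurable_funTS.
- by move=> y; apply: erestrict_ge0 => z _; rewrite lee_fin.
Qed.

(** A weight determined by the past: it stands for the product of the earlier ratios, restricted to
    a past event, and is constant under the inner integral over labels. *)
Variable M : Omega -> R.
Hypothesis mM : measurable_fun (setT : set (g_sigma_algebraType F)) M.
Hypothesis M_ge0 : forall w, 0 <= M w.

Let ps := (fun z => p z.1 z.2) \_ strip.

Let mps : measurable_fun setT ps.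
Proof. exact: ((measurable_restrictT _ mstrip).1 p_meas). Qed.

Let ps_ge0 z : 0 <= ps z.
Proof.
rewrite /ps patchE; case: ifPn => // /[!inE] -[_ Yz].
by have [_ /(_ _ Yz)] := p_dens z.1.
Qed.

(* [q `^ (-1)] stands for [q^-1], whose measurability the library lacks. *)
Let f (z : g_sigma_algebraType F * measurableTypeR R) :=
  M z.1 * (ps z * qs z `^ (-1)).

Let mf : measurable_fun setT f.
Proof.
apply: measurable_funM; first exact: (measurableT_comp mM measurable_fst).
apply: measurable_funM => //.
exact: (measurableT_comp (measurable_powR _) mqs).
Qed.

Let f_ge0 z : 0 <= f z.
Proof. by rewrite !mulr_ge0// powR_ge0. Qed.

(* Where q vanishes the ratio p / q is 0, which is why only [<=] holds. *)
Lemma integral_likelihood_ratio_le :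
  (\int[P]_w (M w * (p w (Z w) / q w (Z w)))%:E <= \int[P]_w (M w)%:E)%E.
Proof.
have -> : (\int[P]_w (M w * (p w (Z w) / q w (Z w)))%:E =
    \int[P]_w (f (W w, Z w))%:E)%E.
  apply: eq_integral => w _; rewrite /f powR_inv1// /ps /qs !patchE.
  by have -> : (W w, Z w) \in strip by rewrite inE; split => //; exact: ZY.
rewrite (ge0_integral_disintegration mqs qs_ge0 cond_rect (f := EFin \o f));
  [|exact/measurable_EFinP|by move=> z; rewrite lee_fin].
have mfq : measurable_fun setT (fun z => (f z)%:E * (qs z)%:E)%E.
  by apply: emeasurable_funM; exact/measurable_EFinP.
apply: ge0_le_integral => //.
- move=> w _; apply: integral_ge0 => y _.
  by rewrite mule_ge0// lee_fin.
- have fq_ge0 z : (0 <= (f z)%:E * (qs z)%:E)%E.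
    by rewrite mule_ge0// lee_fin.
  exact: (measurableT_comp
    (measurable_fun_fubini_tonelli_F (m2 := m) _ mfq fq_ge0) mW).
- apply/measurable_EFinP; exact: (measurableT_comp mM mW).
move=> w _.
have mpw : measurable_fun setT (fun y => (ps (w, y))%:E).
  by apply/measurable_EFinP;
    exact: (measurableT_comp mps (pair1_measurable (W w))).
(* Pointwise [(ps / qs) * qs] is at most [ps]; then [M w] comes out of the integral and [p w]
   integrates to 1. *)
apply: (@le_trans _ _ (\int[m]_y ((M w)%:E * (ps (w, y))%:E))%E).
  apply: ge0_le_integral => //.
  - by move=> y _; rewrite mule_ge0// lee_fin.
  - exact: (measurableT_comp mfq (pair1_measurable (W w))).
  - exact: emeasurable_funM.
  move=> y _; rewrite -!EFinM lee_fin /f /= -mulrA ler_wpM2l//.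
  rewrite powR_inv1//.
  have [->|q0] := eqVneq (qs (w, y)) 0; first by rewrite mulr0.
  by rewrite mulfVK.
rewrite ge0_integralZl_EFin//; last by move=> y _; rewrite lee_fin.
rewrite integral_strip//; last by move=> y; rewrite lee_fin.
rewrite -[leRHS]mule1 lee_wpmul2l ?lee_fin//.
have [_ _ <-] := p_dens w.
rewrite le_eqVlt; apply/orP; left; apply/eqP.
apply: eq_integral => y /[!inE] Yy.
by rewrite /ps patchE ifT// inE.
Qed.

End one_step.

Lemma measurable_fun_lt d (T : measurableType d) (R : realType) (D : set T)
    (f g : T -> R) :
  measurable D -> measurable_fun D f -> measurable_fun D g ->
  measurable (D `&` [set x | f x < g x]).
Proof.
move=> mD mf mg; under eq_set => x do rewrite -lte_fin.
by apply: measurable_lte => //; exact: measurableT_comp.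
Qed.

(** * Ville's maximal inequality *)

Section ville.
Context d (T : measurableType d) (R : realType) (P : probability T R).
Local Open Scope ereal_scope.

(** Splits [A] at level [c] and bounds [f] below by [c] on the upper part. Unlike in Markov's
    inequality, the integral over the lower part is kept, to be used at the next time. *)
Let markov_step (A : set T) (f : T -> R) (c : R) :
  measurable A -> measurable_fun setT f -> (forall x, 0 <= f x)%R ->
    (0 <= c)%R ->
  c%:E * P (A `&` [set x | c < f x]%R) +
    \int[P]_(x in A `&` [set x | f x <= c]%R) (f x)%:E
  <= \int[P]_(x in A) (f x)%:E.
Proof.
move=> mA mf f0 c0.
have mfE D : measurable_fun D (EFin \o f).
  by apply: measurable_funTS; exact/measurable_EFinP.
have mfA : measurable_fun A f by exact: measurable_funTS.
have mgt : measurable (A `&` [set x | c < f x]%R) by exact: measurable_fun_lt.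
have mle : measurable (A `&` [set x | f x <= c]%R) by exact: measurable_fun_le.
have AE : A = (A `&` [set x | c < f x]%R) `|` (A `&` [set x | f x <= c]%R).
  rewrite -setIUr -[LHS]setIT; congr (_ `&` _); apply/esym/seteqP;
    split=> // x _ /=.
  by have [|] := ltP c (f x); [left|right].
rewrite [in leRHS]AE ge0_integral_setU//=; last 2 first.
- by move=> x _; rewrite lee_fin.
- by apply/disj_setPS => x [[_ /= cf] [_ /=]]; rewrite leNgt cf.
rewrite leeD2r// -integral_cst//.
apply: ge0_le_integral => //.
by move=> x [_ /= /ltW]; rewrite lee_fin.
Qed.

Variables (M : nat -> T -> R) (c : R).

(** The event that the first passage above [c] happens after time [n]; it replaces an explicit
    stopping time. *)
Definition below n : set T := [set x | forall k, (k <= n)%N -> (M k x <= c)%R].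

Lemma belowS n : below n.+1 = below n `&` [set x | M n.+1 x <= c]%R.
Proof.
apply/seteqP; split => x.
  by move=> b; split=> [k kn|]; apply: b => //; exact: leqW.
by move=> [b b1] k; rewrite leq_eqVlt => /predU1P[->//|]; exact: b.
Qed.

Lemma below0 : below 0 = [set x | M 0%N x <= c]%R.
Proof.
apply/seteqP; split => x; first exact.
by move=> b k; rewrite leqn0 => /eqP ->.
Qed.

Lemma measurable_below n :
  (forall k, (k <= n)%N -> measurable_fun setT (M k)) -> measurable (below n).
Proof.
elim: n => [|n IH] mM.
  by rewrite below0 -[X in measurable X]setTI;
    apply: measurable_fun_le => //; exact: mM.
rewrite belowS; apply: measurable_fun_le => //.
- by apply: IH => k kn; apply: mM; exact: leqW.
- by apply: measurable_funTS; exact: mM.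
Qed.

Hypotheses (mM : forall n, measurable_fun setT (M n)).
Hypotheses (M0 : forall n x, (0 <= M n x)%R) (c0 : (0 <= c)%R).
Hypothesis M_super : forall n,
  \int[P]_(x in below n) (M n.+1 x)%:E <= \int[P]_(x in below n) (M n x)%:E.

(** Optional stopping at the first passage: a path that has crossed counts [c], any other counts its
    current value, and this total never increases. [M_super] moves the paths still below from [n] to
    [n.+1], then [markov_step] separates those that cross at that moment. *)
Let ville_finite n :
  c%:E * P (~` below n) + \int[P]_(x in below n) (M n x)%:E
    <= \int[P]_x (M 0%N x)%:E.
Proof.
elim: n => [|n IH].
  have -> : ~` below 0 = setT `&` [set x | c < M 0%N x]%R.
    by rewrite setTI below0; apply/seteqP; split => x /=;
      rewrite ltNge => /negP.
  by rewrite -[in integral _ (below 0)](setTI (below 0)) below0;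
    exact: markov_step.
apply: le_trans IH; apply: le_trans (leeD2l _ (M_super n)).
have mb : measurable (below n) by exact: measurable_below.
apply: le_trans (leeD2l _ (markov_step mb (mM n.+1) (M0 n.+1) c0)).
rewrite belowS [leRHS]addeA.
rewrite leeD2r//.
have mgt : measurable (below n `&` [set x | c < M n.+1 x]%R).
  by apply: measurable_fun_lt => //; exact: measurable_funTS.
(* Paths crossing at time [n.+1] are disjoint from those that crossed earlier, so the two multiples
   of [c] merge. *)
rewrite -ge0_muleDr ?measure_ge0// -measureU//; last 2 first.
- exact: measurableC.
- by rewrite setIA setICl set0I.
rewrite le_eqVlt; apply/orP; left; apply/eqP; congr (_ * P _).
apply/seteqP; split => x /=.
  have [bx|] := pselect (below n x); last by left.
  by move=> /not_andP[//|/negP]; rewrite -ltNge; right.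
by move=> [nb [/nb]//|[_ cM] [_]]; rewrite leNgt cM.
Qed.

Lemma ville :
  c%:E * P (\bigcup_n [set x | (c < M n x)%R]) <= \int[P]_x (M 0%N x)%:E.
Proof.
have -> : \bigcup_n [set x | (c < M n x)%R] = \bigcup_n ~` below n.
  apply/seteqP; split => x [n _].
    by move=> /= cM; exists n => // /(_ n (leqnn n)); rewrite leNgt cM.
  by move=> /existsNP[k /not_implyP[_ /negP]]; rewrite -ltNge; exists k.
have mcb n : measurable (~` below n) by apply: measurableC;
  exact: measurable_below.
have cvg_cP : c%:E * P (~` below n)
  @[n --> \oo] --> c%:E * P (\bigcup_n ~` below n).
  apply: cvgeZl => //; apply: nondecreasing_cvg_mu => //.
    exact: bigcup_measurable.
  move=> n k nk; apply/subsetPset/subsetC => x b i i_n.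
  exact: b (leq_trans i_n nk).
rewrite -(cvg_lim _ cvg_cP)//; apply: lime_le; first exact: cvgP cvg_cP.
near=> n; apply: le_trans (ville_finite n); rewrite leeDl//.
by apply: integral_ge0 => x _; rewrite lee_fin.
Unshelve. all: by end_near. Qed.

End ville.

(** * Measurability with respect to the filtration *)

Section filtration_lemmas.
Context {R : realType} {d : nat} {disp : measure_display}
  {Omega : measurableType disp}.
Variables (X : nat -> Omega -> 'rV[R]_d) (Y : nat -> Omega -> R).

Lemma sigma_algebra_data m k : sigma_algebra setT (sigma_data X Y m k).
Proof. exact: smallest_sigma_algebra. Qed.

Lemma sub_sigma_data m k m' k' : (m <= m')%N -> (k <= k')%N ->
  sigma_data X Y m k `<=` sigma_data X Y m' k'.
Proof.
move=> mm kk; apply: sub_sigma_algebra2; apply: setUSS;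
  apply: bigcup_subset => t /=.
  by move=> /andP[-> /leq_trans ->].
by move=> /andP[-> /leq_trans ->].
Qed.

Lemma sigma_data_sub_measurable m k :
  (forall t, (1 <= t)%N -> measurable_rV (X t)) ->
  (forall t, (1 <= t)%N -> measurable_fun setT (Y t)) ->
  sigma_data X Y m k `<=` measurable.
Proof.
move=> mX mY; apply: smallest_sub; first exact: sigma_algebra_measurable.
move=> A [[t /= /andP[t1 _] [i _ [B mB <-]]]|[t /= /andP[t1 _] [B mB <-]]].
  exact: mX.
exact: mY.
Qed.

Lemma measurable_label m k t : (1 <= t <= k)%N ->
  measurable_fun setT (Y t : g_sigma_algebraType (sigma_data X Y m k) -> R).
Proof.
(* Two inclusions: [g_sigma_algebraType] generates anew from [sigma_data], which is itself
   generated. *)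
move=> tk _ B mB; apply: sub_sigma_algebra; apply: sub_sigma_algebra.
by right; exists t => //; exists B.
Qed.

End filtration_lemmas.

Lemma measurable_fun_sub d (T : measurableType d) (R : realType)
    (F : set_system T) (f : T -> R) :
  F `<=` measurable ->
  measurable_fun setT (f : g_sigma_algebraType F -> R) -> measurable_fun setT f.
Proof. by move=> FT mf; exact: (measurableT_comp mf (measurable_id_sub FT)). Qed.

(** Composition with the graph map of [Z]. It makes a predictable density, evaluated at the label it
    predicts, measurable once that label is known. *)
Lemma jointly_measurable_comp (R : realType) disp (Omega : measurableType disp)
    (Ysp : set (measurableTypeR R)) (F G : set_system Omega)
    (g : Omega -> R -> R) (Z : Omega -> R) :
  measurable Ysp -> F `<=` G -> jointly_measurable Ysp F g ->
  measurable_fun setT (Z : g_sigma_algebraType G -> R) ->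
  (forall w, Ysp (Z w)) ->
  measurable_fun setT ((fun w => g w (Z w)) : g_sigma_algebraType G -> R).
Proof.
move=> mYsp FG mg mZ ZY.
have FG' : F `<=` (measurable : set (set (g_sigma_algebraType G))).
  by move=> A /FG GA; exact: sub_sigma_algebra.
have mid := @measurable_id_sub _ (g_sigma_algebraType G) F FG'.
pose WZ (w : g_sigma_algebraType G) :
    g_sigma_algebraType F * measurableTypeR R := (w, Z w).
have mWZ : measurable_fun setT WZ by exact: measurable_fun_pair.
apply: (measurable_comp _ _ mg mWZ); first exact: measurableX.
by move=> _ [w _ <-]; split => //; exact: ZY.
Qed.

Lemma measurable_lne_EFin (R : realType) :
  measurable_fun setT (fun r : R => lne r%:E).
Proof.
apply: measurable_fun_ifT => //; first exact: measurable_fun_ler.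
by apply/measurable_EFinP; exact: measurable_ln.
Qed.

Lemma measurable_dotv (R : realType) d disp (T : measurableType disp)
    (u v : T -> 'rV[R]_d) :
  measurable_rV u -> measurable_rV v ->
    measurable_fun setT (fun w => dotv (u w) (v w)).
Proof. by move=> mu mv; apply: measurable_sum => i; exact: measurable_funM. Qed.

(** * Likelihood ratios and confidence sets *)

Section likelihood_ratio.
Context {R : realType} {d : nat} {Omega : Type}.
Variables (psi h : R -> R).
Variables (X : nat -> Omega -> 'rV[R]_d) (Y : nat -> Omega -> R).
Variables (p : nat -> Omega -> R -> R) (theta : 'rV[R]_d).

(** The index shift skips time 0 of the data, so the value at 0 is the empty product 1. A factor
    whose denominator vanishes is 0. *)
Definition likelihood_ratio (n : nat) (w : Omega) : R :=
  \prod_(t < n) (p t.+1 w (Y t.+1 w) /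
                 glm_density psi h (X t.+1 w) theta (Y t.+1 w)).

Lemma likelihood_ratioS n w : likelihood_ratio n.+1 w =
  likelihood_ratio n w * (p n.+1 w (Y n.+1 w) /
                          glm_density psi h (X n.+1 w) theta (Y n.+1 w)).
Proof. by rewrite /likelihood_ratio big_ord_recr. Qed.

(** With [h] positive at the labels all GLM losses are finite, the losses of [thetabar] cancel, and
    exponentiating the defining inequality of the set gives the bound on the ratio. *)
Lemma conf_set_likelihood_ratio (thetabar : nat -> Omega -> 'rV[R]_d)
    (delta : R) (n : nat) (w : Omega) :
  (forall t, 0 <= p t.+1 w (Y t.+1 w)) -> (forall t, 0 < h (Y t.+1 w)) ->
  0 < delta -> likelihood_ratio n w <= delta^-1 ->
  conf_set psi h X Y p thetabar delta n w theta.
Proof.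
move=> p_ge0 h_gt0 delta_gt0 Mle.
pose a th t := - (dotv th (X t.+1 w) * Y t.+1 w) + psi (dotv th (X t.+1 w))
  - ln (h (Y t.+1 w)).
have lossE t th : loss psi h X Y t.+1 w th = (a th t)%:E.
  by rewrite /loss /glm_loss lne_EFin.
have pE t : expR (- a theta t) = glm_density psi h (X t.+1 w) theta (Y t.+1 w).
  by rewrite /a /glm_density opprB opprD opprK addrC expRD lnK// posrE.
rewrite /conf_set /= /beta /regret !big_add1 /= !big_mkord.
under eq_bigr do rewrite !lossE -EFinB.
rewrite sumEFin.
(* If some [p] vanishes at its label, the regret and hence [beta] are [+oo], and the constraint is
   void. Otherwise every term is real. *)
have [[t tn pt0]|pn0] :=
    pselect (exists2 t : nat, (t < n)%N & p t.+1 w (Y t.+1 w) = 0).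
  have -> : (\sum_(i < n) (log_loss (p i.+1 w) (Y i.+1 w) -
      loss psi h X Y i.+1 w (thetabar n w)) = +oo)%E.
    apply/esum_eqyP => [i _|].
      rewrite lossE /log_loss; have := p_ge0 i;
        rewrite le_eqVlt => /predU1P[<-|p_gt0].
        by rewrite le0_lneNy.
      by rewrite lne_EFin.
    exists (Ordinal tn); split => //=; [exact: mem_index_enum|].
    by rewrite lossE /log_loss pt0 le0_lneNy.
  by rewrite addye// leey.
have p_gt0 (t : 'I_n) : 0 < p t.+1 w (Y t.+1 w).
  rewrite lt_neqAle p_ge0 andbT; apply/eqP => /esym pt0.
  by apply: pn0; exists t.
under [in leRHS]eq_bigr do rewrite lossE /log_loss lne_EFin// -EFinN -EFinB.
(* Collects both sums on the left, so that [thetabar] cancels termwise and only the log-ratio is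
   compared with [ln (1 / delta)]. *)
rewrite sumEFin -EFinD lee_fin -lerBlDl -sumrB.
rewrite div1r -ler_expR lnK ?posrE ?invr_gt0//.
apply: le_trans Mle; rewrite expR_sum le_eqVlt; apply/orP; left; apply/eqP.
apply: eq_bigr => t _; rewrite -pE -expRN opprK -[X in X * _]lnK ?posrE//.
by rewrite -expRD; congr expR; ring.
Qed.

End likelihood_ratio.

(** * Coverage of the confidence sequence *)

Theorem theorem2p2 (R : realType) (d : nat) (hd : (1 <= d)%N)
    (Ysp : set (measurableTypeR R)) (mYsp : measurable Ysp)
    (mu : {measure set (measurableTypeR R) -> \bar R})
    (mu_sigma_finite : sigma_finite Ysp mu)
    (h psi : R -> R)
    (h_ge0 : forall y, Ysp y -> 0 <= h y)
    (psi_convex : convex_function (setT : set R^o) psi)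
    (psi_diff : forall u : R, derivable psi u 1)
    (glm_dens : forall x theta : 'rV[R]_d,
        is_density Ysp mu (glm_density psi h x theta))
    (disp : measure_display) (Omega : measurableType disp)
    (P : probability Omega R)
    (X : nat -> Omega -> 'rV[R]_d) (Y : nat -> Omega -> R)
    (mX : forall t, (1 <= t)%N -> measurable_rV (X t))
    (mY : forall t, (1 <= t)%N -> measurable_fun setT (Y t))
    (Y_in : forall t w, (1 <= t)%N -> Ysp (Y t w))
    (thetastar : 'rV[R]_d)
    (Y_cond : forall t, (1 <= t)%N ->
        conditional_density Ysp (filtration X Y t.-1) P mu (Y t)
          (fun w => glm_density psi h (X t w) thetastar))
    (p : nat -> Omega -> R -> R)
    (p_dens : forall t w, (1 <= t)%N -> is_density Ysp mu (p t w))
    (p_meas : forall t, (1 <= t)%N ->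
        jointly_measurable Ysp (filtration X Y t.-1) (p t))
    (thetabar : nat -> Omega -> 'rV[R]_d)
    (thetabar_meas : forall n, (1 <= n)%N ->
        measurable_rV
          (thetabar n : g_sigma_algebraType (sigma_data X Y n n) -> 'rV[R]_d))
    (delta : R) (delta_gt0 : 0 < delta) (delta_lt1 : delta < 1) :
  (P [set w | exists n : nat, (1 <= n)%N /\
        ~ conf_set psi h X Y p thetabar delta n w thetastar]
     <= delta%:E)%E.
Proof.
pose Fn n := filtration X Y n.
have sF n : sigma_algebra setT (Fn n) by exact: sigma_algebra_data.
have Fm n : Fn n `<=` measurable by exact: sigma_data_sub_measurable.
have Fle k n : (k <= n)%N -> Fn k `<=` Fn n.
  by move=> kn; apply: sub_sigma_data.
pose q t w := glm_density psi h (X t w) thetastar.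
have YI t w : Ysp (Y t.+1 w) by exact: Y_in.
have q_ge0 t w y : Ysp y -> 0 <= q t w y.
  by move=> Yy; rewrite mulr_ge0 ?expR_ge0// h_ge0.
have p_ge0 t w : 0 <= p t.+1 w (Y t.+1 w).
  by have [_ /(_ _ (YI t w))] := p_dens t.+1 w isT.
pose M := likelihood_ratio psi h X Y p thetastar.
have M_ge0 n w : 0 <= M n w.
  by apply: prodr_ge0 => t _; rewrite divr_ge0// q_ge0.
have mlab n t g : (t < n)%N -> jointly_measurable Ysp (Fn t) g ->
    measurable_fun setT
      ((fun w => g w (Y t.+1 w)) : g_sigma_algebraType (Fn n) -> R).
  move=> tn mg;
    apply: (jointly_measurable_comp mYsp (Fle _ _ (ltnW tn)) mg) => //.
  exact: measurable_label.
have mM n : measurable_fun setT (M n : g_sigma_algebraType (Fn n) -> R).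
  apply: measurable_prod => t _.
  under eq_fun do rewrite -powR_inv1 ?q_ge0//.
  apply: measurable_funM;
    first exact: (mlab _ _ _ (ltn_ord t) (p_meas t.+1 isT)).
  apply: (measurableT_comp (measurable_powR _)).
  exact: (mlab _ _ _ (ltn_ord t) (Y_cond t.+1 isT).1).
have mMO n : measurable_fun setT (M n)
  by exact: measurable_fun_sub (Fm n) (mM n).
have mMle n k : (k <= n)%N ->
  measurable_fun setT (M k : g_sigma_algebraType (Fn n) -> R).
  move=> kn.
  have Fkn : Fn k `<=` (measurable : set (set (g_sigma_algebraType (Fn n)))).
    by move=> A /(Fle _ _ kn) FA; exact: sub_sigma_algebra.
  exact: (@measurable_fun_sub _ (g_sigma_algebraType (Fn n)) R (Fn k) (M k) Fkn
    (mM k)).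
have M_super n : (\int[P]_(w in below M delta^-1 n) (M n.+1 w)%:E <=
    \int[P]_(w in below M delta^-1 n) (M n w)%:E)%E.
  (* The event [below] at time [n] depends only on [M k] with [k <= n], so its indicator can be
     absorbed into the past weight of the one-step inequality. *)
  pose M' w := M n w * \1_(below M delta^-1 n) w.
  have mM' : measurable_fun setT (M' : g_sigma_algebraType (Fn n) -> R).
    apply: measurable_funM; first exact: mM.
    apply: measurable_indic.
    by apply: (@measurable_below _ (g_sigma_algebraType (Fn n))) => k;
      exact: mMle.
  have M'_ge0 w : 0 <= M' w by rewrite mulr_ge0.
  have := integral_likelihood_ratio_le mYsp mu_sigma_finite (sF n) (Fm n)
    (mY n.+1 isT) (YI n) (q_ge0 n.+1) (Y_cond n.+1 isT)
    (fun w => p_dens n.+1 w isT) (p_meas n.+1 isT) mM' M'_ge0.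
  congr (_ <= _)%E; rewrite [RHS]integral_mkcond; apply: eq_integral => w _.
    by rewrite epatch_indic /M' -EFinM /M likelihood_ratioS mulrAC.
  by rewrite epatch_indic -EFinM.
have dV_ge0 : 0 <= delta^-1 by rewrite invr_ge0 ltW.
have := ville mMO M_ge0 dV_ge0 M_super.
have -> : (\int[P]_w (M 0%N w)%:E = 1)%E.
  transitivity (\int[P]_w cst 1%E w)%E.
    by apply: eq_integral => w _; rewrite /M /likelihood_ratio big_ord0.
  by rewrite integral_cst// mul1e; exact: probability_setT.
rewrite muleC -lee_pdivlMr ?invr_gt0// mul1e invrK => PM_le.
(* The exceptional events on which a loss may be infinite. *)
pose N t := Y t.+1 @^-1` (Ysp `&` [set y | h y <= 0]).
(* Measurability of [h] is read off the model density at zero covariate and parameter, which is [h]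
   times the constant [expR (- psi 0)]. *)
have mh : measurable_fun Ysp (h : measurableTypeR R -> R).
  have [mg _ _] := glm_dens 0 0.
  rewrite (_ : h = fun y => @glm_density R d psi h 0 0 y
    * expR (psi (@dotv R d 0 0))).
    exact: measurable_funM.
  have dot0 : @dotv R d 0 0 = 0.
    by apply: big1 => i _; rewrite mxE mul0r.
  apply/funext => y; rewrite /glm_density dot0 mul0r add0r mulrAC -expRD addNr.
  by rewrite expR0 mul1r.
have mN0 : measurable (Ysp `&` [set y : measurableTypeR R | h y <= 0]).
  exact: measurable_fun_le.
have mN t : measurable (N t).
  by rewrite -[N t]setTI; exact: mY.
(* The conditional density has the factor [h], so it vanishes on the label set defining [N t];
   conditioning on the sure event gives probability 0. *)
have PN t : P (N t) = 0.
  have FT : Fn t setT.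
    by have [F0 FC _] := sF t; rewrite -[setT]setD0; exact: FC.
  have := (Y_cond t.+1 isT).2 setT _ FT mN0 (@subIsetl _ _ _).
  rewrite setTI => ->; rewrite integral0_eq// => w _; rewrite integral0_eq//.
  move=> y [Yy hy]; rewrite /glm_density.
  have -> : h y = 0 by apply/eqP; rewrite eq_le hy h_ge0.
  by rewrite mulr0.
(* The next facts lead to measurability of the failure event, which comparing probabilities by
   monotonicity requires. *)
have mhY t : measurable_fun setT (fun w => h (Y t.+1 w)).
  apply: (measurable_comp mYsp _ mh (mY t.+1 isT)).
  by move=> _ [w _ <-]; exact: YI.
have mpY t : measurable_fun setT (fun w => p t.+1 w (Y t.+1 w)).
  exact: (measurable_fun_sub (Fm t.+1)
    (mlab _ _ _ (ltnSn t) (p_meas t.+1 isT))).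
have mpsi : measurable_fun setT psi.
  apply: continuous_measurable_fun => x.
  exact/differentiable_continuous/derivable1_diffP/psi_diff.
have mloss t (th : Omega -> 'rV[R]_d) : measurable_rV th ->
    measurable_fun setT (fun w => loss psi h X Y t.+1 w (th w)).
  move=> mth; have mdot := measurable_dotv mth (mX t.+1 isT).
  apply: emeasurable_funB.
    apply/measurable_EFinP; apply: measurable_funD.
      apply: measurableT_comp => //; apply: measurable_funM => //.
      exact: mY.
    exact: (measurableT_comp mpsi mdot).
  exact: (measurableT_comp (@measurable_lne_EFin R) (mhY t)).
have mbar n : (1 <= n)%N -> measurable_rV (thetabar n).
  move=> n1 i; apply: (measurable_fun_sub _ (thetabar_meas n n1 i)).
  exact: sigma_data_sub_measurable.
have mconf n : (1 <= n)%N ->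
    measurable [set w | conf_set psi h X Y p thetabar delta n w thetastar].
  move=> n1; rewrite -[X in measurable X]setTI; apply: measurable_lee => //.
    under eq_fun do rewrite big_add1 /= big_mkord.
    apply: emeasurable_sum => t; apply: emeasurable_funB; apply: mloss => //.
    exact: mbar.
  apply: emeasurable_funD => //.
  under eq_fun do rewrite /regret big_add1 /= big_mkord.
  apply: emeasurable_sum => t; apply: emeasurable_funB; last exact/mloss/mbar.
  apply: measurableT_comp => //.
  exact: (measurableT_comp (@measurable_lne_EFin R) (mpY t)).
have mML n : measurable [set w | delta^-1 < M n w].
  by rewrite -[X in measurable X]setTI; exact: measurable_fun_lt.
have mU := bigcup_measurable (P := setT) (fun n _ => mML n).
have mUN := bigcup_measurable (P := setT) (fun n _ => mN n).
have PUN : P (\bigcup_n N n) = 0%E.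
  apply: measure_negligible => //; apply: negligible_bigcup => t.
  exact: ((negligibleP P (mN t)).2 (PN t)).
(* Adding the null union of the [N t] to the crossing event keeps its probability and makes it
   contain the failure event. *)
apply: le_trans PM_le; rewrite -(measureU0 mU mUN PUN).
apply: le_measure; rewrite ?inE.
- rewrite (_ : mkset _ = \bigcup_(n in [set n | (1 <= n)%N])
      ~` [set w | conf_set psi h X Y p thetabar delta n w thetastar]).
    by apply: bigcup_measurable => n n1; exact/measurableC/mconf.
  by apply/seteqP; split => w [n]; [move=> [n1 nc]; exists n|exists n].
- exact: measurableU.
move=> w [n [n1 nconf]].
have [|nN] := pselect ((\bigcup_t N t) w); [by right|left].
exists n => //=; rewrite ltNge; apply/negP => Mle; apply: nconf.
apply: conf_set_likelihood_ratio => // t.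
rewrite ltNge; apply/negP => hY; apply: nN; exists t => //; split => //;
  exact: YI.
Qed.
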